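(* Let $\lambda,\mu,\theta,\Delta>0$ and $\rho:=\lambda/\mu$. Let $(q_1(t),q_2(t))$, $t\ge 0$, be a solution of $$\dot q_i(t)=\lambda\,\frac{\exp\left(-\theta\, q_i(\Phi(t,\Delta))\right)}{\sum_{j=1}^{2}\exp\left(-\theta\, q_j(\Phi(t,\Delta))\right)}-\mu q_i(t),\quad i=1,2,\qquad \Phi(t,\Delta):=\left\lfloor \frac{t}{\Delta}\right\rfloor\Delta ,$$ and suppose that a Hopf bifurcation occurs (in the sense defined in the context). Then the steady-state minimum $L$ of the queue lengths is the non-trivial solution $L<\rho/2$ of the fixed-point equation $$\rho-L=L e^{-\mu\Delta}+\rho\,\frac{e^{-\theta L}}{e^{-\theta L}+e^{-\theta(\rho-L)}}\left(1-e^{-\mu\Delta}\right),$$ and the amplitude of the oscillations is given by $$\mathrm{Amplitude}=\frac{\rho}{2}-L .$$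
   Context: A solution is a pair of continuous real functions on $[0,\infty)$, with given initial values $q_1(0),q_2(0)$, such that the differential equation holds on each interval $[k\Delta,(k+1)\Delta)$, $k=0,1,2,\dots$ (one-sided derivative at the left endpoint); on such an interval $\Phi(t,\Delta)=k\Delta$. The equilibrium is $q_1=q_2=\rho/2$. ''A Hopf bifurcation occurs'' means that the system is past its critical delay, i.e. $\frac{\lambda\theta}{2\mu}>1$ and $\Delta>\Delta_{\rm cr}:=\frac{1}{\mu}\ln\left(1+\frac{2}{\frac{\lambda\theta}{2\mu}-1}\right)$, and that the solution considered is an oscillating one, i.e. $(q_1(t),q_2(t))$ does not converge to the equilibrium $(\rho/2,\rho/2)$ as $t\to\infty$. The steady-state minimum and maximum are the long-time lower and upper values of the queue lengths, $L=\liminf_{t\to\infty}q_i(t)$ and $U=\limsup_{t\to\infty}q_i(t)$ (the same for $i=1,2$), and the amplitude of the oscillations is $(U-L)/2$. The trivial solution of the fixed-point equation is $L=\rho/2$. *)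

(* Defs.v *)
From HB Require Import structures.
From mathcomp Require Import all_boot all_order all_algebra.
From mathcomp Require Import all_classical all_reals all_analysis.
Set Implicit Arguments.
Unset Strict Implicit.
Unset Printing Implicit Defensive.
Import Order.TTheory GRing.Theory Num.Theory.
Import numFieldNormedType.Exports.
Local Open Scope classical_set_scope.
Local Open Scope ring_scope.

Section Queues.
Context {R : realType}.
Implicit Types (lambda mu theta Delta rho L U t : R) (q : 'I_2 -> R -> R).

Definition Phi t Delta : R := (Num.floor (t / Delta))%:~R * Delta.

Definition rhs lambda mu theta Delta q (i : 'I_2) t : R :=
  lambda * (expR (- theta * q i (Phi t Delta))
            / \sum_(j < 2) expR (- theta * q j (Phi t Delta)))
  - mu * q i t.

Definition is_right_derive (f : R -> R) t (v : R) : Prop :=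
  h^-1 * (f (t + h) - f t) @[h --> 0^'+] --> v.

(* Only the values of q on [0, +oo[ are constrained; the interior points of
   the intervals [k Delta, (k+1) Delta[ are all positive, so the two-sided
   derivative there does not see negative times. *)
Definition is_solution lambda mu theta Delta (q0 : 'I_2 -> R) q : Prop :=
  forall i : 'I_2,
    [/\ {within [set t | 0 <= t], continuous (q i)},
        q i 0 = q0 i,
        forall k : nat,
          is_right_derive (q i) (k%:R * Delta)
            (rhs lambda mu theta Delta q i (k%:R * Delta))
      & forall (k : nat) (t : R), k%:R * Delta < t < k.+1%:R * Delta ->
          is_derive t 1 (q i) (rhs lambda mu theta Delta q i t)].

Definition Delta_cr lambda mu theta : R :=
  mu^-1 * ln (1 + 2 / (lambda * theta / (2 * mu) - 1)).

Definition converges_to_equilibrium rho q : Prop :=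
  (q ord0 t, q ord_max t) @[t --> +oo] --> (rho / 2, rho / 2).

Definition hopf_bifurcation lambda mu theta Delta q : Prop :=
  [/\ 1 < lambda * theta / (2 * mu),
      Delta_cr lambda mu theta < Delta
    & ~ converges_to_equilibrium (lambda / mu) q].

(* Extended-real liminf and limsup at infinity: no boundedness is presupposed
   when these are said to equal real numbers. *)
Definition steady_state_min (f : R -> R) : \bar R :=
  limf_einf (fun t => (f t)%:E) (pinfty_nbhs R).

Definition steady_state_max (f : R -> R) : \bar R :=
  limf_esup (fun t => (f t)%:E) (pinfty_nbhs R).

Definition amplitude L U : R := (U - L) / 2.

Definition fixed_point_eq rho mu theta Delta L : Prop :=
  rho - L = L * expR (- mu * Delta)
    + rho * (expR (- theta * L)
             / (expR (- theta * L) + expR (- theta * (rho - L))))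
      * (1 - expR (- mu * Delta)).

Definition nontrivial_solution rho mu theta Delta L : Prop :=
  L < rho / 2 /\ fixed_point_eq rho mu theta Delta L.

End Queues.

(* Main.v *)
Require Import Defs.
From mathcomp Require Import all_boot all_order all_algebra.
From mathcomp Require Import all_classical all_reals all_analysis.
From mathcomp Require Import ring lra.
Set Implicit Arguments.
Unset Strict Implicit.
Unset Printing Implicit Defensive.
Import Order.TTheory GRing.Theory Num.Theory.
Import numFieldNormedType.Exports.
Local Open Scope classical_set_scope.
Local Open Scope ring_scope.

(** Between two multiples of Delta the arrival rates are frozen, so the
    equations are linear with constant coefficients and are solved explicitly
    ([linear_ode_flow], [queue_flow]). Write [a := expR (- mu * Delta)] and
    [c := rho * (1 - a)].

    The total length q_1 + q_2 relaxes exponentially to rho ([total_cvg]),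
    whatever the routing does. The gap D = q_1 - q_2, read at the multiples of
    Delta, obeys a scalar recursion of its own, D' = a D - c tanh(theta D / 2),
    because the difference of the two softmax probabilities is minus the
    hyperbolic tangent of half of theta D ([softmax2E], [gap_node_step]). The
    whole theorem is thus about the odd map [gap_map].

    A 2-cycle {d, -d} of this map is a root of c tanh(theta d / 2) = (1 + a) d.
    Being past the critical delay says exactly that the left side is steeper at
    the origin than the right side ([past_critical_delay]); as tanh is bounded
    and strictly concave on the half-line, there is one and only one positive
    root ([htanh_root_exists], [htanh_root_unique]). With d = rho - 2 L this
    root equation is the fixed-point equation for L ([fixed_point_eqE]).

    The 2-cycle attracts every orbit that never hits 0 ([gap_orbit_cvg]). On
    every half-line of sizes at least m > 0, the map x |-> |gap_map x| brings
    |x| closer to d by a factor k < 1: the slopes of - gap_map seen from d lie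
    between - a, by monotonicity of tanh, and the slope of the chord from m to
    d, by concavity, and this last slope is below 1 because gap_map expands
    below d ([gap_map_contract]). An orbit for which some |D_n| is at distance
    less than d from d stays away from 0, and so does one with |D_n| >= 2 d for
    all n; there is no other case, so |D_n| tends to d. Near the cycle signs
    alternate, so D_n accumulates at both d and - d. An orbit that does hit 0
    stays there and the queues converge to the equilibrium, which the
    hypothesis excludes ([gap_node_neq0]).

    Inside an interval the gap is a convex combination of its two end values
    ([norm_segment_le]), so its continuous-time lower and upper limits are - d
    and d. Since q_1 and q_2 are half of the sum and of the difference of total
    and gap, both have lower limit (rho - d) / 2 = L and upper limit
    (rho + d) / 2 = rho - L, and the amplitude is d / 2 = rho / 2 - L. *)

(** * The hyperbolic tangent and the softmax *)

(** This is tanh(theta x / 2). *)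
Definition htanh {R : realType} (theta x : R) : R :=
  (expR (theta * x) - 1) / (expR (theta * x) + 1).

Lemma htanh_den_gt0 {R : realType} (theta x : R) : 0 < expR (theta * x) + 1.
Proof. by rewrite addr_gt0 ?expR_gt0. Qed.

Lemma htanh_den_neq0 {R : realType} (theta x : R) : expR (theta * x) + 1 != 0.
Proof. exact: lt0r_neq0 (htanh_den_gt0 _ _). Qed.

Lemma htanh0 {R : realType} (theta : R) : htanh theta 0 = 0.
Proof. by rewrite /htanh mulr0 expR0 subrr mul0r. Qed.

Lemma htanhN {R : realType} (theta x : R) : htanh theta (- x) = - htanh theta x.
Proof.
have e0 : expR (theta * x) != 0 by rewrite gt_eqF ?expR_gt0.
have e1 := htanh_den_neq0 theta x.
rewrite /htanh mulrN expRN; field.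
by rewrite e1 e0.
Qed.

Lemma htanh_lt1 {R : realType} (theta x : R) : htanh theta x < 1.
Proof.
rewrite /htanh ltr_pdivrMr ?htanh_den_gt0// mul1r.
by rewrite ltrD2l (lt_trans (ltrN10 _)).
Qed.

(** The routing depends on the two queues through their difference alone; this
    is what decouples the gap from the total. *)
Lemma softmax2E {R : realType} (theta x y : R) :
  expR (- theta * x) / (expR (- theta * x) + expR (- theta * y)) =
  (1 - htanh theta (x - y)) / 2.
Proof.
have -> : - theta * y = - theta * x + theta * (x - y) by ring.
rewrite expRD /htanh.
have := htanh_den_neq0 theta (x - y).
set u := expR (- _ * _); set v := expR _ => v1.
have u0 : u != 0 by rewrite gt_eqF ?expR_gt0.
field.
rewrite v1 -{1}[u]mulr1 -mulrDr mulf_neq0// addrC //.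
Qed.

Lemma is_derive_expR_scale {R : realType} (k x : R) :
  is_derive x 1 (fun y => expR (k * y)) (expR (k * x) * k).
Proof.
apply: (@is_derive1_comp R expR ( *%R k) x (expR (k * x)) k).
by have := is_deriveZ (f := id) k (is_derive_id x 1); rewrite scaler1.
Qed.

Lemma is_derive_htanh {R : realType} (theta x : R) :
  is_derive x 1 (htanh theta) (theta / 2 * (1 - htanh theta x ^+ 2)).
Proof.
have e1 := htanh_den_neq0 theta x.
have dg := is_derive_expR_scale theta x.
have dd : is_derive x 1 (fun y => expR (theta * y) + 1) (expR (theta * x) * theta + 0).
  exact: is_deriveD.
rewrite /htanh.
have [ed dd'] := dd.
have di : is_derive x 1 (fun y => (expR (theta * y) + 1)^-1)
   (- (expR (theta * x) + 1) ^- 2 *: (expR (theta * x) * theta + 0)).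
  apply: DeriveDef; first exact: derivableV.
  by rewrite deriveV// dd'.
have dn : is_derive x 1 (fun y => expR (theta * y) - 1) (expR (theta * x) * theta - 0).
  exact: is_deriveB.
apply: (is_derive_eq (is_deriveM dn di)).
rewrite /GRing.scale/=.
by field.
Qed.

Lemma ltr_htanh {R : realType} (theta x y : R) : 0 < theta ->
  x < y -> htanh theta x < htanh theta y.
Proof.
move=> theta0 xy; rewrite /htanh ltr_pdivrMr ?htanh_den_gt0// mulrAC.
rewrite ltr_pdivlMr ?htanh_den_gt0//.
have : expR (theta * x) < expR (theta * y) by rewrite ltr_expR ltr_pM2l.
lra.
Qed.

Lemma htanh_gt0 {R : realType} (theta x : R) : 0 < theta ->
  0 < x -> 0 < htanh theta x.
Proof. by move=> theta0 x0; rewrite -(htanh0 theta) ltr_htanh. Qed.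

Lemma htanh_ge0 {R : realType} (theta x : R) : 0 < theta ->
  0 <= x -> 0 <= htanh theta x.
Proof.
move=> theta0; rewrite le_eqVlt => /predU1P[<-|x0]; first by rewrite htanh0.
exact/ltW/htanh_gt0.
Qed.

Lemma continuous_htanh {R : realType} (theta : R) : continuous (htanh theta).
Proof.
move=> x; apply/differentiable_continuous/derivable1_diffP.
by have [] := is_derive_htanh theta x.
Qed.

Lemma htanh_MVT {R : realType} (theta x y : R) : x < y ->
  exists2 z, x < z < y &
  htanh theta y - htanh theta x = theta / 2 * (1 - htanh theta z ^+ 2) * (y - x).
Proof.
move=> xy.
have [||z] := @MVT R (htanh theta) (fun z => theta / 2 * (1 - htanh theta z ^+ 2)) x y xy.
- by move=> z _; exact: is_derive_htanh.
- exact/continuous_subspaceT/continuous_htanh.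
- by rewrite in_itv/=; exists z.
Qed.

(** The derivative theta / 2 (1 - tanh^2) strictly decreases on the half-line,
    so the mean slope over the right segment is below that over the left one. *)
Lemma htanh_concave {R : realType} (theta x y z : R) : 0 < theta ->
  0 <= x -> x < y -> y < z ->
  (htanh theta z - htanh theta y) * (y - x) <
  (htanh theta y - htanh theta x) * (z - y).
Proof.
move=> theta0 x0 xy yz.
have [u /andP[xu uy] ->] := htanh_MVT theta xy.
have [v /andP[yv vz] ->] := htanh_MVT theta yz.
rewrite -mulrA [_ * (y - x)]mulrC mulrA.
rewrite ltr_pM2r ?subr_gt0// ltr_pM2r ?subr_gt0// ltr_pM2l; last by rewrite divr_gt0.
rewrite ltrD2l ltrN2 ltr_pXn2r// ?nnegrE ?htanh_ge0//; try lra.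
by rewrite ltr_htanh//; lra.
Qed.

Lemma htanh_slope_decr {R : realType} (theta x y : R) : 0 < theta ->
  0 < x -> x < y -> htanh theta y * x < htanh theta x * y.
Proof.
move=> theta0 x0 xy; have := htanh_concave theta0 (lexx 0) x0 xy.
by rewrite htanh0 !subr0; lra.
Qed.

(** The curve starts above the line of slope s, since its initial slope is
    larger, and is below it at c / s, since tanh < 1. *)
Lemma htanh_root_exists {R : realType} (theta c s : R) : 0 < theta ->
  0 < s -> s < c * (theta / 2) ->
  exists2 d, 0 < d & c * htanh theta d = s * d.
Proof.
move=> theta0 s0 sG; set G := c * _ in sG.
have G0 : 0 < G by exact: lt_trans sG.
have c0 : 0 < c by move: G0; rewrite /G pmulr_lgt0 ?divr_gt0.
(* With w := theta x / 2 = 1 - s / G, the derivative of the curve on [0, x] is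
   at least G (1 - w^2) > G (1 - w) = s, so the curve is above the line at x. *)
pose x := 2 / theta * (1 - s / G).
have sG1 : s / G < 1 by rewrite ltr_pdivrMr// mul1r.
have sG0 : 0 < s / G by rewrite divr_gt0.
have x0 : 0 < x by rewrite mulr_gt0 ?divr_gt0 ?subr_gt0.
have [u /andP[u0 ux]] := htanh_MVT theta x0.
rewrite htanh0 !subr0 => Tx.
have [v /andP[v0 vu]] := htanh_MVT theta u0.
rewrite htanh0 !subr0 => Tu.
have Tv0 : 0 < htanh theta v by exact: htanh_gt0.
have Tu0 : 0 < htanh theta u by exact: htanh_gt0.
have Tu1 : htanh theta u <= 1 - s / G.
  have -> : 1 - s / G = theta / 2 * x by rewrite /x; field; lra.
  rewrite Tu ler_pM// ?mulr_ge0 ?divr_ge0 ?(ltW theta0) ?(ltW u0) ?(ltW ux)//.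
    by have := htanh_lt1 theta v; nra.
  by rewrite ler_piMr ?divr_ge0 ?(ltW theta0)//; nra.
have sx : s * x < c * htanh theta x.
  have -> : c * htanh theta x = G * (1 - htanh theta u ^+ 2) * x.
    by rewrite Tx /G; ring.
  rewrite ltr_pM2r// -[ltLHS](@divfK _ G) ?gt_eqF//.
  by rewrite mulrC ltr_pM2l//; nra.
have xy : x < c / s.
  rewrite ltr_pdivlMr// mulrC (lt_trans sx)//.
  by rewrite gtr_pMr// htanh_lt1.
have fy : c * htanh theta (c / s) < s * (c / s).
  by rewrite [ltRHS]mulrC divfK ?gt_eqF// gtr_pMr// htanh_lt1.
pose f t := c * htanh theta t - s * t.
have cf : continuous f.
  move=> t; apply: cvgB; last by apply: cvgMr; exact: cvg_id.
  by apply: cvgMr; exact: continuous_htanh.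
have [|d] := @IVT R f x (c / s) 0 (ltW xy) (continuous_subspaceT cf).
  by rewrite /f ge_min le_max; lra.
rewrite in_itv/= => /andP[xd _] /eqP; rewrite subr_eq0 => /eqP fd.
by exists d => //; exact: lt_le_trans xd.
Qed.

(** A strictly concave curve through the origin meets a line through the origin
    at most once more. *)
Lemma htanh_root_unique {R : realType} (theta c s d d' : R) : 0 < theta ->
  0 < c -> 0 < d -> 0 < d' ->
  c * htanh theta d = s * d -> c * htanh theta d' = s * d' -> d = d'.
Proof.
move=> theta0 c0; wlog dd' : d d' / d < d' => [hwlog|d0 d'0 ed ed'].
  by have [dd'|d'd|//] := ltgtP d d' => d0 d'0 ed ed'; [|apply/esym]; exact: hwlog.
have := htanh_slope_decr theta0 d0 dd'.
rewrite -(ltr_pM2l c0) mulrA ed' mulrA ed.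
by rewrite mulrAC ltxx.
Qed.

(** * The sampled gap dynamics *)

(** One sampling step for the difference of the queue lengths. *)
Definition gap_map {R : realType} (theta a c x : R) : R :=
  a * x - c * htanh theta x.

Lemma gap_mapN {R : realType} (theta a c x : R) :
  gap_map theta a c (- x) = - gap_map theta a c x.
Proof. by rewrite /gap_map htanhN; ring. Qed.

Lemma gap_map0 {R : realType} (theta a c : R) : gap_map theta a c 0 = 0.
Proof. by rewrite /gap_map htanh0 !mulr0 subrr. Qed.

Lemma norm_gap_map {R : realType} (theta a c x : R) :
  `|gap_map theta a c x| = `|gap_map theta a c `|x| |.
Proof. by have [//|] := ger0P x; rewrite gap_mapN normrN. Qed.

(** On ]0, d[ the curve lies above its chord from 0 to d, which makes the image
    larger in size, with the opposite sign. *)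
Lemma gap_map_expand {R : realType} (theta a c d e : R) : 0 < theta ->
  0 < c -> 0 < d -> c * htanh theta d = (1 + a) * d -> 0 < e -> e < d ->
  gap_map theta a c e < - e.
Proof.
move=> theta0 c0 d0 hd e0 ed; have := htanh_slope_decr theta0 e0 ed.
rewrite -(ltr_pM2l c0) mulrA hd mulrA /gap_map => H.
suff : (1 + a) * e < c * htanh theta e by lra.
by rewrite -(ltr_pM2r d0); lra.
Qed.

(** This and the next lemma say that [- gap_map] never descends faster than at
    rate [a]: its tanh term is increasing. *)
Lemma gap_map_drop {R : realType} (theta a c d e : R) : 0 < theta ->
  0 < c -> c * htanh theta d = (1 + a) * d -> d <= e ->
  gap_map theta a c e + d <= a * (e - d).
Proof.
move=> theta0 c0 hd; rewrite le_eqVlt => /predU1P[<-|de].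
  by rewrite /gap_map; lra.
have := ltr_htanh theta0 de; rewrite -(ltr_pM2l c0) hd /gap_map; lra.
Qed.

Lemma gap_map_rise {R : realType} (theta a c d e : R) : 0 < theta ->
  0 < c -> c * htanh theta d = (1 + a) * d -> e <= d ->
  - gap_map theta a c e - d <= a * (d - e).
Proof.
move=> theta0 c0 hd; rewrite le_eqVlt => /predU1P[->|ed].
  by rewrite /gap_map; lra.
have := ltr_htanh theta0 ed; rewrite -(ltr_pM2l c0) hd /gap_map; lra.
Qed.

Lemma gap_map_lt0 {R : realType} (theta a c d e : R) : 0 < theta ->
  0 < a < 1 -> 0 < c -> 0 < d -> c * htanh theta d = (1 + a) * d ->
  0 < e -> e < 2 * d -> gap_map theta a c e < 0.
Proof.
move=> theta0 /andP[a0 a1] c0 d0 hd e0 e2d; have [ed|de] := ltP e d.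
  by have := gap_map_expand theta0 c0 d0 hd e0 ed; lra.
have := gap_map_drop theta0 c0 hd de; nra.
Qed.

(** The slopes of [- gap_map] seen from its fixed point d lie between [- a] and
    the slope of the chord from m to d. Folding the image by the absolute value
    does no harm: a change of sign occurs only for gaps above d, where the
    folded image is at most [a * e]. *)
Lemma gap_map_contract {R : realType} (theta a c d m : R) : 0 < theta ->
  0 < a < 1 -> 0 < c -> 0 < d -> c * htanh theta d = (1 + a) * d ->
  0 < m -> m < d ->
  exists2 k, 0 <= k < 1 &
    forall e, m <= e -> `| `|gap_map theta a c e| - d| <= k * `|e - d|.
Proof.
move=> theta0 /andP[a0 a1] c0 d0 hd m0 md; have m_ge0 := ltW m0.
have dm : 0 < d - m by rewrite subr_gt0.
pose k := (d + gap_map theta a c m) / (d - m).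
have kE : k * (d - m) = d + gap_map theta a c m by rewrite divfK// gt_eqF.
have k1 : k < 1.
  rewrite ltr_pdivrMr// mul1r.
  by have := gap_map_expand theta0 c0 d0 hd m0 md; lra.
exists (Num.max a k); first by rewrite le_max (ltW a0) gt_max a1.
move=> e me; have e0 := lt_le_trans m0 me.
have [ed|de] := ltP e d.
  have he := gap_map_expand theta0 c0 d0 hd e0 ed.
  have rise := gap_map_rise theta0 c0 hd (ltW ed).
  have chord : d + gap_map theta a c e <= k * (d - e).
    move: me; rewrite le_eqVlt => /predU1P[<-|me]; first by rewrite kE.
    rewrite -(ler_pM2r dm) mulrAC kE.
    have := htanh_concave theta0 m_ge0 me ed.
    by rewrite -(ltr_pM2l c0) /gap_map; nra.
  rewrite (ltr0_norm (lt_trans he _)) ?oppr_lt0// (ltr0_norm (x := e - d)) ?subr_lt0//.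
  rewrite ler_norml opprB; apply/andP; split.
    apply: (@le_trans _ _ (- (k * (d - e)))); last by lra.
    by rewrite lerN2 ler_pM2r ?subr_gt0// le_max lexx orbT.
  apply: (le_trans rise); rewrite ler_pM2r ?subr_gt0// le_max lexx//.
have drop := gap_map_drop theta0 c0 hd de.
have a_max : a * (e - d) <= Num.max a k * (e - d).
  by rewrite ler_wpM2r ?subr_ge0// le_max lexx.
have k_max : k * (e - d) <= Num.max a k * (e - d).
  by rewrite ler_wpM2r ?subr_ge0// le_max lexx orbT.
have chord : - gap_map theta a c e - d <= k * (e - d).
  move: de; rewrite le_eqVlt => /predU1P[<-|de]; first by rewrite /gap_map; lra.
  rewrite -(ler_pM2r dm) mulrAC kE.
  have := htanh_concave theta0 m_ge0 md de.
  by rewrite -(ltr_pM2l c0) /gap_map; nra.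
rewrite (ger0_norm (x := e - d)) ?subr_ge0// ler_norml.
have ae : a * d < d by rewrite gtr_pMl.
have gae : gap_map theta a c e <= a * e.
  by rewrite /gap_map lerBlDl lerDr mulr_ge0 ?(ltW c0)// htanh_ge0// ltW.
by have [|] := ger0P (gap_map theta a c e) => he; apply/andP; split; lra.
Qed.

Lemma geometric_decay {R : realType} (k : R) (u : nat -> R) (N : nat) :
  0 <= k < 1 -> (forall n, 0 <= u n) ->
  (forall n, (N <= n)%N -> u n.+1 <= k * u n) -> u @ \oo --> 0.
Proof.
move=> /andP[k0 k1] u0 uS; rewrite -(cvg_shiftn N).
have uE n : u (n + N)%N <= u N * k ^+ n.
  elim: n => [|n IHn]; first by rewrite expr0 mulr1.
  rewrite addSn exprS mulrCA (le_trans (uS _ _)) ?leq_addl//.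
  exact: ler_wpM2l.
apply: (@squeeze_cvgr _ _ _ _ (fun=> 0) (geometric (u N) k)).
- by apply: nearW => n; rewrite u0 uE.
- exact: cvg_cst.
- by apply: cvg_geometric; rewrite ger0_norm.
Qed.

Section gap_orbit.
Context {R : realType} (theta a c d : R) (D : nat -> R).
Hypotheses (theta0 : 0 < theta) (a01 : 0 < a < 1) (c0 : 0 < c) (d0 : 0 < d).
Hypothesis hd : c * htanh theta d = (1 + a) * d.
Hypothesis DS : forall n, D n.+1 = gap_map theta a c (D n).
Hypothesis D_neq0 : forall n, D n != 0.

Lemma gap_orbit_trapped (m : R) (N : nat) : 0 < m -> m < d ->
  (forall n, (N <= n)%N -> m <= `|D n|) -> `|D n| @[n --> \oo] --> d.
Proof.
move=> m0 md Dm.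
have [k k01 contr] := gap_map_contract theta0 a01 c0 d0 hd m0 md.
suff : (fun n => `| `|D n| - d |) @ \oo --> 0.
  by move/norm_cvg0P/subr_cvg0.
apply: (geometric_decay k01 (fun=> normr_ge0 _)) => n /Dm.
by rewrite DS norm_gap_map; exact: contr.
Qed.

(** Either some |D_N| is at distance r < d from d, and then the later |D_n| never
    leave the ball of radius r around d, hence stay above d - r > 0; or every
    |D_n| is at least 2 d. In both cases the orbit is bounded away from 0. *)
Lemma gap_orbit_cvg : `|D n| @[n --> \oo] --> d.
Proof.
have [[N]|noN] := pselect (exists N, `| `|D N| - d| < d).
  (* The first bound only keeps m below d when r = 0. *)
  set r := `| _ |; move=> rd; pose m := Num.min (d / 2) (d - r).
  have m0 : 0 < m by rewrite lt_min divr_gt0 ?subr_gt0.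
  have md : m < d by rewrite gt_min ltr_pdivrMr// ltr_pMr// ltr1n.
  have mr e : `|e - d| <= r -> m <= e.
    by rewrite ler_norml ge_min => /andP[? _]; apply/orP; right; lra.
  have [k /andP[k0 k1] contr] := gap_map_contract theta0 a01 c0 d0 hd m0 md.
  apply: (gap_orbit_trapped (N := N) m0 md) => n Nn; apply: (mr).
  elim: n Nn => [|n IHn]; first by rewrite leqn0 => /eqP <-.
  rewrite leq_eqVlt => /predU1P[<-//|/IHn Dr]; rewrite DS norm_gap_map.
  apply: (le_trans (contr _ (mr _ Dr))).
  by rewrite (le_trans _ Dr)// ler_piMl// ltW.
apply: (gap_orbit_trapped (m := d / 2) (N := 0)) => [||n _].
- by rewrite divr_gt0.
- by rewrite ltr_pdivrMr// ltr_pMr// ltr1n.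
have : ~~ (`| `|D n| - d| < d) by apply/negP => Dd; apply: noN; exists n.
have : 0 < `|D n| by rewrite normr_gt0.
rewrite ltr_norml; lra.
Qed.

(** The |D_n| eventually lie below 2 d, and there the map reverses signs. *)
Lemma gap_orbit_alternates :
  \forall n \near \oo, D n.+1 * D n < 0.
Proof.
have /cvgrPdist_lt/(_ d d0) := gap_orbit_cvg.
apply: filterS => n; rewrite distrC ltr_norml => /andP[_ Dd].
have Dn0 : 0 < `|D n| by rewrite normr_gt0.
have : gap_map theta a c `|D n| < 0.
  by apply: (gap_map_lt0 theta0 a01 c0 d0 hd Dn0); lra.
have [Dge|Dlt] := ger0P (D n).
  by rewrite DS => ?; rewrite nmulr_rlt0// -(ger0_norm Dge).
by rewrite gap_mapN oppr_lt0 DS => ?; rewrite pmulr_rlt0.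
Qed.

(** Among two consecutive late gaps one is positive, hence close to d. The
    values close to - d follow by applying this to the opposite orbit. *)
Lemma gap_orbit_frequently (e : R) (N : nat) : 0 < e ->
  exists2 n, (N <= n)%N & d - e < D n.
Proof.
move=> e0; have /cvgrPdist_lt/(_ e e0)[M _ DM] := gap_orbit_cvg.
have [M' _ alt] := gap_orbit_alternates.
pose n := maxn N (maxn M M').
have [Nn Mn M'n] : [/\ N <= n, M <= n & M' <= n]%N.
  by rewrite !leq_max !leqnn !orbT.
have [Dge|Dlt] := leP 0 (D n).
  by exists n => //; have := DM _ Mn; rewrite /= (ger0_norm Dge) ltr_norml; lra.
have D1 : 0 < D n.+1 by have := alt _ M'n; rewrite /= nmulr_llt0.
exists n.+1; first exact: leqW.
have := DM _ (leqW Mn); rewrite /= (gtr0_norm D1) ltr_norml; lra.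
Qed.

End gap_orbit.

(** * Explicit flow between sampling times *)

(** The function (f - lam / mu) exp(mu t) has zero derivative. *)
Lemma linear_ode_flow {R : realType} (lam mu t0 t1 : R) (f : R -> R) :
  mu != 0 -> {within `[t0, t1], continuous f} ->
  (forall t, t0 < t < t1 -> is_derive t 1 f (lam - mu * f t)) ->
  forall t, t0 <= t <= t1 ->
  f t = expR (- mu * (t - t0)) * f t0
        + (1 - expR (- mu * (t - t0))) * (lam / mu).
Proof.
move=> mu0 fC fD t /andP[t0t tt1].
pose E s := expR (mu * s).
have dE (s : R) : is_derive s 1 E (expR (mu * s) * mu).
  exact: is_derive_expR_scale.
pose g s := (f s - lam / mu) * E s.
have gD (s : R) : s \in `]t0, t[ -> is_derive s 1 g (cst 0 s).
  rewrite in_itv/= => /andP[t0s st].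
  have /fD dfs : t0 < s < t1 by rewrite t0s (lt_le_trans st).
  have dfs' : is_derive s 1 (fun s => f s - lam / mu) (lam - mu * f s - 0).
    exact: is_deriveB.
  apply: (is_derive_eq (is_deriveM dfs' (dE s))).
  rewrite /GRing.scale/= /E.
  by field.
have gC : {within `[t0, t], continuous g}.
  have fC' : {within `[t0, t], continuous f}.
    by apply: continuous_subspaceW fC => s /=; rewrite !in_itv/= => /andP[-> /le_trans->].
  have EC : {within `[t0, t], continuous E}.
    apply: continuous_subspaceT => s.
    by apply/differentiable_continuous/derivable1_diffP; have [] := dE s.
  move=> s; apply: cvgM; last exact: EC.
  by apply: cvgB; [exact: fC'|exact: cvg_cst].
have [z _] := MVT_segment t0t gD gC.
rewrite mul0r /g /E => /eqP; rewrite subr_eq0 => /eqP gt.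
have -> : - mu * (t - t0) = mu * t0 - mu * t by ring.
rewrite expRB.
have e0 : expR (mu * t) != 0 by rewrite gt_eqF ?expR_gt0.
have -> : f t = (f t0 - lam / mu) * expR (mu * t0) / expR (mu * t) + lam / mu.
  by rewrite -gt mulfK// subrK.
by field; rewrite mu0 e0.
Qed.

Lemma Phi_itv {R : realType} (Delta t : R) (k : nat) : 0 < Delta ->
  k%:R * Delta <= t < k.+1%:R * Delta -> Phi t Delta = k%:R * Delta.
Proof.
move=> D0 /andP[kt tk]; rewrite /Phi (@floor_def _ _ k%:Z)//.
by rewrite ler_pdivlMr// ltr_pdivrMr// kt /= intrD natr1.
Qed.

(** A statement about large times may be proved one sampling interval at a
    time. *)
Lemma sampled_near {R : realType} (Delta : R) (P : R -> Prop) : 0 < Delta ->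
  (\forall n \near \oo, forall t, n%:R * Delta <= t <= n.+1%:R * Delta -> P t) ->
  \forall t \near +oo, P t.
Proof.
move=> D0 [N _ NP]; exists (N%:R * Delta); split; first exact: num_real.
move=> t /ltW Nt.
have t0 : 0 <= t / Delta.
  by rewrite divr_ge0 ?(le_trans _ Nt) ?mulr_ge0 ?(ltW D0).
have /andP[kt tk] := truncn_itv t0.
apply: (NP (Num.truncn (t / Delta))).
  by rewrite /= truncn_ge_nat// ler_pdivlMr.
by rewrite -ler_pdivlMr// kt -ler_pdivrMr// ltW.
Qed.

Lemma queue_flow {R : realType} (lambda mu theta Delta : R) (q0 : 'I_2 -> R)
    (q : 'I_2 -> R -> R) (k : nat) (t : R) :
  0 < mu -> 0 < Delta -> is_solution lambda mu theta Delta q0 q ->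
  k%:R * Delta <= t <= k.+1%:R * Delta ->
  let tk := k%:R * Delta in
  let w := expR (- mu * (t - tk)) in
  let h := htanh theta (q ord0 tk - q ord_max tk) in
  q ord0 t = w * q ord0 tk + (1 - w) * (lambda / mu * ((1 - h) / 2)) /\
  q ord_max t = w * q ord_max tk + (1 - w) * (lambda / mu * ((1 + h) / 2)).
Proof.
move=> mu0 D0 sol tk_t tk w h.
have tk0 : 0 <= tk by rewrite mulr_ge0// ltW.
have flow i : q i t = w * q i tk + (1 - w) * (lambda / mu *
    (expR (- theta * q i tk) / \sum_(j < 2) expR (- theta * q j tk))).
  have [qC _ _ qD] := sol i.
  set P := expR _ / _; rewrite [lambda / mu * _]mulrAC.
  have mu_neq0 : mu != 0 by rewrite gt_eqF.
  apply: (@linear_ode_flow R (lambda * P) mu tk (k.+1%:R * Delta) (q i)) => //.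
    apply: continuous_subspaceW qC => s /=; rewrite in_itv/= => /andP[+ _].
    exact: le_trans.
  move=> s sk; have := qD k s sk; rewrite /rhs (@Phi_itv _ _ _ k)//.
  by case/andP: sk => /ltW -> ->.
rewrite !flow !big_ord_recl big_ord0 addr0.
have -> : lift ord0 ord0 = ord_max :> 'I_2 by exact: val_inj.
rewrite softmax2E; split=> //.
by rewrite [expR _ + _]addrC softmax2E -(opprB (q ord0 tk)) htanhN opprK.
Qed.

(** * Upper limits, the fixed-point equation and the critical delay *)

(** The upper limit of a real function at infinity, in the elementary form that
    is stable under adding a convergent function. *)
Definition is_limsup {R : realType} (f : R -> R) (u : R) : Prop :=
  forall e, 0 < e ->
    (\forall t \near +oo, f t < u + e) /\
    (forall M, exists2 t, M < t & u - e < f t).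

Lemma steady_state_maxE {R : realType} (f : R -> R) (u : R) :
  is_limsup f u -> steady_state_max f = u%:E.
Proof.
move=> fu; rewrite /steady_state_max limf_esupE.
apply/eqP; rewrite eq_le; apply/andP; split.
  apply/lee_addgt0Pr => e e0; have [fe _] := fu e e0.
  apply: (@le_trans _ _ (ereal_sup ((fun t => (f t)%:E) @` [set t | f t < u + e]))).
    by apply: ereal_inf_lbound; exists [set t | f t < u + e].
  by apply: ge_ereal_sup => _ [t /= ft <-]; rewrite -EFinD lee_fin ltW.
apply: le_ereal_inf_tmp => _ [V [M [_ MV]] <-].
apply/lee_subgt0Pr => e e0; have [_ /(_ M)[t Mt ft]] := fu e e0.
apply: (@le_trans _ _ (f t)%:E); first by rewrite -EFinB lee_fin ltW.
by apply: ereal_sup_ubound; exists t => //; exact: MV.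
Qed.

Lemma steady_state_minE {R : realType} (f : R -> R) (u : R) :
  is_limsup (fun t => - f t) (- u) -> steady_state_min f = u%:E.
Proof.
move=> /steady_state_maxE; rewrite /steady_state_min /limf_einf => fu.
have -> : (\- (fun t => (f t)%:E))%E = (fun t => (- f t)%:E) by [].
by rewrite -[u]opprK EFinN -fu.
Qed.

Lemma is_limsup_half {R : realType} (g f tot : R -> R) (s u : R) :
  (forall t, f t = (tot t + g t) / 2) -> tot t @[t --> +oo] --> s ->
  is_limsup g u -> is_limsup f ((s + u) / 2).
Proof.
move=> fE /cvgrPdist_lt tots gu e e0.
have [ge gM] := gu e e0; split.
  near=> t; rewrite fE.
  have : `|s - tot t| < e by near: t; exact: tots.
  have : g t < u + e by near: t; exact: ge.
  by rewrite ltr_norml; lra.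
move=> M; have [M' [_ totM]] := tots e e0.
have [t] := gM (Num.max M M'); rewrite gt_max => /andP[Mt M't] gt.
exists t => //; rewrite fE; have := totM _ M't.
by rewrite /= ltr_norml; lra.
Unshelve. all: end_near. Qed.

(** The unknown d = rho - 2 L is the distance between the two extreme values
    L and rho - L. *)
Lemma fixed_point_eqE {R : realType} (rho mu theta Delta L : R) :
  let a := expR (- mu * Delta) in
  fixed_point_eq rho mu theta Delta L <->
  rho * (1 - a) * htanh theta (rho - 2 * L) = (1 + a) * (rho - 2 * L).
Proof.
move=> a; rewrite /fixed_point_eq softmax2E -/a.
have -> : L - (rho - L) = - (rho - 2 * L) by ring.
by rewrite htanhN; split; lra.
Qed.

(** With K = lambda theta / (2 mu), the critical delay is where
    exp(mu Delta) = (K + 1) / (K - 1), that is K (1 - a) = 1 + a. *)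
Lemma past_critical_delay {R : realType} (lambda mu theta Delta : R) :
  0 < mu -> 1 < lambda * theta / (2 * mu) ->
  Delta_cr lambda mu theta < Delta ->
  1 + expR (- mu * Delta) < lambda / mu * (1 - expR (- mu * Delta)) * (theta / 2).
Proof.
move=> mu0; rewrite /Delta_cr; set K := lambda * theta / _ => K1.
have K10 : 0 < K - 1 by rewrite subr_gt0.
have y0 : 0 < 1 + 2 / (K - 1) by rewrite addr_gt0 ?divr_gt0.
rewrite mulrC ltr_pdivrMr// -ltr_expR lnK ?posrE// mulNr expRN [Delta * _]mulrC.
set E := expR _ => KE.
have E0 : 0 < E by rewrite expR_gt0.
have -> : lambda / mu * (1 - E^-1) * (theta / 2) = K * (1 - E^-1).
  by rewrite /K; field; rewrite ?gt_eqF.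
have KE' : K + 1 < E * (K - 1).
  by rewrite -ltr_pdivrMr//; apply: le_lt_trans KE; rewrite le_eqVlt; apply/orP; left;
    apply/eqP; field; rewrite gt_eqF.
rewrite -(ltr_pM2r E0) mulrDl -mulrA mulrBl mulVf ?gt_eqF//; lra.
Qed.

(** As w runs from 1 down to a, the combination of x and y runs along the
    segment between its two end values. *)
Lemma norm_segment_le {R : realType} (a w x y B : R) : a < 1 -> a <= w <= 1 ->
  `|x| <= B -> `|a * x + (1 - a) * y| <= B -> `|w * x + (1 - w) * y| <= B.
Proof.
move=> a1 /andP[aw w1]; rewrite !ler_norml => /andP[x1 x2] /andP[y1 y2].
have a10 : 0 < 1 - a by rewrite subr_gt0.
apply/andP; split; rewrite -(ler_pM2l a10); nra.
Qed.

(** * The sampled queueing system *)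

Section sampled_system.
Context {R : realType} (lambda mu theta Delta : R).
Context (q0 : 'I_2 -> R) (q : 'I_2 -> R -> R).
Hypotheses (mu0 : 0 < mu) (Delta0 : 0 < Delta).
Hypothesis q_sol : is_solution lambda mu theta Delta q0 q.

Let rho := lambda / mu.
Let a := expR (- mu * Delta).
Let c := rho * (1 - a).
Let gap t := q ord0 t - q ord_max t.
Let total t := q ord0 t + q ord_max t.
Let node (n : nat) := n%:R * Delta.

Lemma decay_itv : 0 < a < 1.
Proof. by rewrite expR_gt0 -expR0 ltr_expR mulNr oppr_lt0 mulr_gt0. Qed.

Lemma node_itv n : node n <= node n.+1 <= node n.+1.
Proof. by rewrite lexx andbT ler_pM2r// ler_nat. Qed.

Lemma node_decay n : expR (- mu * (node n.+1 - node n)) = a.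
Proof. by rewrite -mulrBl -natr1 addrAC subrr add0r mul1r. Qed.

Lemma decay_bounds n t : node n <= t <= node n.+1 ->
  a <= expR (- mu * (t - node n)) <= 1.
Proof.
move=> /andP[nt tn]; rewrite -(node_decay n) ler_expR !mulNr lerN2 ler_pM2l//.
by rewrite lerB//= -expR0 ler_expR oppr_le0 mulr_ge0 ?subr_ge0// ltW.
Qed.

Lemma gap_flow n t : node n <= t <= node n.+1 ->
  let w := expR (- mu * (t - node n)) in
  gap t = w * gap (node n) + (1 - w) * (- (rho * htanh theta (gap (node n)))).
Proof.
move=> nt w; have [] := queue_flow mu0 Delta0 q_sol nt.
by rewrite -/(node n) /gap -/w => -> ->; rewrite -/rho; lra.
Qed.

Lemma gap_node_step n : gap (node n.+1) = gap_map theta a c (gap (node n)).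
Proof. by rewrite (gap_flow (node_itv n)) node_decay /gap_map /c; ring. Qed.

Lemma gap_near_le B : (\forall n \near \oo, `|gap (node n)| <= B) ->
  \forall t \near +oo, `|gap t| <= B.
Proof.
move=> [N _ NB]; apply: (sampled_near Delta0); exists N => // n Nn t nt.
have /andP[_ a1] := decay_itv.
rewrite (gap_flow nt) (norm_segment_le a1 (decay_bounds nt)) ?NB//.
by rewrite -(node_decay n) -(gap_flow (node_itv n)) NB//= leqW.
Qed.

Lemma total_flow n t : node n <= t <= node n.+1 ->
  total t - rho = expR (- mu * (t - node n)) * (total (node n) - rho).
Proof.
move=> nt; have [] := queue_flow mu0 Delta0 q_sol nt.
by rewrite -/(node n) /total => -> ->; rewrite -/rho; lra.
Qed.

Lemma total_cvg : total t @[t --> +oo] --> rho.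
Proof.
have /andP[a0 a1] := decay_itv.
have nodes : `|total (node n) - rho| @[n --> \oo] --> 0.
  apply: (geometric_decay (k := a) (N := 0)); [by rewrite ltW|by []|].
  by move=> n _; rewrite (total_flow (node_itv n)) node_decay normrM (gtr0_norm a0).
apply/subr_cvg0/cvgr0Pnorm_le => e e0.
move/cvgr0Pnorm_le : nodes => /(_ e e0)[N _ Ne].
apply: (sampled_near Delta0); exists N => // n /Ne/= ne t nt.
have /andP[_ w1] := decay_bounds nt.
rewrite (total_flow nt) normrM (ger0_norm (expR_ge0 _)).
by rewrite (le_trans _ ne)// normr_id ler_piMl.
Qed.

Lemma queue_total_gap t :
  q ord0 t = (total t + gap t) / 2 /\ q ord_max t = (total t + - gap t) / 2.
Proof. by rewrite /total /gap; split; lra. Qed.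

(** The total always converges to rho, so an oscillation can only come from the
    gap. *)
Lemma gap_cvg0_equilibrium : gap t @[t --> +oo] --> 0 ->
  converges_to_equilibrium rho q.
Proof.
move=> gap0; rewrite /converges_to_equilibrium.
have half s : ((total t + gap t * s) / 2) @[t --> +oo] --> rho / 2.
  apply: cvgMl; rewrite -[rho]addr0; apply: cvgD total_cvg _.
  by rewrite -(mul0r s); exact: cvgMl.
have cvg0 : q ord0 t @[t --> +oo] --> rho / 2.
  have -> : q ord0 = fun t => (total t + gap t * 1) / 2; last exact: half.
  by apply/funext => t; rewrite mulr1; have [] := queue_total_gap t.
have cvg1 : q ord_max t @[t --> +oo] --> rho / 2.
  have -> : q ord_max = fun t => (total t + gap t * - 1) / 2; last exact: half.
  by apply/funext => t; rewrite mulrN1; have [] := queue_total_gap t.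
exact: cvg_pair cvg0 cvg1.
Qed.

(** 0 is fixed by [gap_map]: once equal at a sampling time, the queues stay
    equal. *)
Lemma gap_node_neq0 n : ~ converges_to_equilibrium rho q -> gap (node n) != 0.
Proof.
move=> not_eq; apply/eqP => gap0; apply/not_eq/gap_cvg0_equilibrium.
apply/cvgr0Pnorm_le => e e0; apply: gap_near_le; exists n => // m /= nm.
suff -> : gap (node m) = 0 by rewrite normr0 ltW.
elim: m nm => [|m IHm]; first by rewrite leqn0 => /eqP <-.
rewrite leq_eqVlt => /predU1P[<-//|/IHm gm].
by rewrite gap_node_step gm gap_map0.
Qed.

Lemma gap_limsup (d : R) : 0 < theta -> 0 < c -> 0 < d ->
  c * htanh theta d = (1 + a) * d -> ~ converges_to_equilibrium rho q ->
  is_limsup gap d /\ is_limsup (fun t => - gap t) d.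
Proof.
move=> theta0 c0 d0 hd not_eq.
have gap_neq0 n := gap_node_neq0 n not_eq.
have normd := gap_orbit_cvg theta0 decay_itv c0 d0 hd gap_node_step gap_neq0.
have gap_le e : 0 < e -> \forall t \near +oo, `|gap t| <= d + e / 2.
  move=> e0; apply: gap_near_le; move/cvgrPdist_le : normd => /(_ (e / 2)).
  rewrite divr_gt0// => /(_ isT); apply: filterS => n.
  by rewrite distrC ler_norml; lra.
have reach M : exists N, forall n, (N <= n)%N -> M < node n.
  exists (Num.truncn (M / Delta)).+1 => n Nn.
  rewrite -ltr_pdivrMr// (lt_le_trans (truncnS_gt _))// ler_nat//.
split=> e e0; split.
- by apply: filterS (gap_le e e0) => t; rewrite ler_norml; lra.
- move=> M; have [N NM] := reach M.
  have [n Nn dn] := gap_orbit_frequently theta0 decay_itv c0 d0 hd gap_node_step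
    gap_neq0 N e0.
  by exists (node n) => //; exact: NM.
- by apply: filterS (gap_le e e0) => t; rewrite ler_norml; lra.
- move=> M; have [N NM] := reach M.
  have step n : - gap (node n.+1) = gap_map theta a c (- gap (node n)).
    by rewrite gap_node_step gap_mapN.
  have neq0 n : - gap (node n) != 0 by rewrite oppr_eq0 gap_neq0.
  have [n Nn dn] := gap_orbit_frequently theta0 decay_itv c0 d0 hd step neq0 N e0.
  by exists (node n) => //; exact: NM.
Qed.

End sampled_system.

(** * Amplitude of the oscillations *)

Theorem theorem2p2 (R : realType) (lambda mu theta Delta : R)
    (q0 : 'I_2 -> R) (q : 'I_2 -> R -> R)
    (lambda_gt0 : 0 < lambda) (mu_gt0 : 0 < mu)
    (theta_gt0 : 0 < theta) (Delta_gt0 : 0 < Delta)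
    (q_sol : is_solution lambda mu theta Delta q0 q)
    (q_hopf : hopf_bifurcation lambda mu theta Delta q) :
  let rho := lambda / mu in
  exists L U : R,
    [/\ forall i : 'I_2, steady_state_min (q i) = L%:E,
        forall i : 'I_2, steady_state_max (q i) = U%:E,
        nontrivial_solution rho mu theta Delta L,
        forall L' : R, nontrivial_solution rho mu theta Delta L' -> L' = L
      & amplitude L U = rho / 2 - L].
Proof.
move=> rho; have [K1 crit not_eq] := q_hopf.
have a01 := decay_itv mu_gt0 Delta_gt0.
have slope := past_critical_delay mu_gt0 K1 crit.
move: a01 slope; rewrite -/rho; set a := expR _ => /andP[a0 a1] slope.
have rho0 : 0 < rho by rewrite divr_gt0.
have c0 : 0 < rho * (1 - a) by rewrite mulr_gt0// subr_gt0.
have a1_0 : 0 < 1 + a by rewrite addr_gt0.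
have [d d0 hd] := htanh_root_exists theta_gt0 a1_0 slope.
have [sup_gap sup_Ngap] := gap_limsup mu_gt0 Delta_gt0 q_sol theta_gt0 c0 d0 hd not_eq.
have tot := total_cvg mu_gt0 Delta_gt0 q_sol.
have totN : - (q ord0 t + q ord_max t) @[t --> +oo] --> - rho by exact: cvgN tot.
have two (i : 'I_2) : i = ord0 \/ i = ord_max.
  by case: (unliftP ord0 i) => [j ->|->]; [right; rewrite [j]ord1; exact: val_inj|left].
exists ((rho - d) / 2), ((rho + d) / 2); split.
- move=> i; apply: steady_state_minE.
  have -> : - ((rho - d) / 2) = (- rho + d) / 2 by lra.
  have [->|->] := two i.
  + by apply: (is_limsup_half _ totN sup_Ngap) => t /=; lra.
  + by apply: (is_limsup_half _ totN sup_gap) => t /=; lra.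
- move=> i; apply: steady_state_maxE; have [->|->] := two i.
  + by apply: (is_limsup_half _ tot sup_gap) => t /=; lra.
  + by apply: (is_limsup_half _ tot sup_Ngap) => t /=; lra.
- split; first by lra.
  by apply/fixed_point_eqE; rewrite -/a (_ : rho - _ = d)//; lra.
- move=> L' [L'rho /fixed_point_eqE]; rewrite -/a => hL'.
  have dL' : 0 < rho - 2 * L' by lra.
  have := htanh_root_unique theta_gt0 c0 d0 dL' hd hL'; lra.
- by rewrite /amplitude; lra.
Qed.
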